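(* For all integers $n \ge 1$, $\mathcal{R}(S_\infty,nK_2)$ is empty.
   Context: All graphs are simple, countable (finite or countably infinite), and have no isolated vertices. $S_\infty=K_{1,\infty}$ is the countably infinite star; $nK_2$ is a matching with $n$ edges. A subgraph $H$ of $G$ has $V(H)\subseteq V(G)$ and $E(H)\subseteq E(G)$; it is proper if $E(H)$ is a proper subset of $E(G)$. We write $F \to (G,H)$ if every red-blue coloring of the edges of $F$ produces a subgraph isomorphic to $G$ with all edges red or a subgraph isomorphic to $H$ with all edges blue. A graph $F$ is $(G,H)$-minimal if $F \to (G,H)$ and no proper subgraph $F'$ of $F$ satisfies $F' \to (G,H)$. $\mathcal{R}(G,H)$ denotes the collection of all $(G,H)$-minimal graphs. *)

(* Defs.v *)
From mathcomp Require Import all_boot.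
From mathcomp Require Import boolp classical_sets functions cardinality.

Set Implicit Arguments.
Unset Strict Implicit.
Unset Printing Implicit Defensive.

Local Open Scope classical_set_scope.

(* The vertex set is a subset of an ambient type [V], so that a graph and its
   subgraphs have the same type. *)
Record graph (V : Type) := Graph {
  vertices : set V;
  edges : set (set V);
  edges_pair : forall e, edges e ->
    exists x y, [/\ vertices x, vertices y, x <> y & e = [set x; y]];
  no_isolated : forall x, vertices x -> exists2 e, edges e & e x;
  vertices_countable : countable vertices }.

Definition adjacent V (G : graph V) (x y : V) : Prop := edges G [set x; y].

Definition subgraph V (H G : graph V) : Prop :=
  vertices H `<=` vertices G /\ edges H `<=` edges G.

Definition proper_subgraph V (H G : graph V) : Prop :=
  subgraph H G /\ edges H `<` edges G.

Definition isomorphic V W (G : graph V) (H : graph W) : Prop :=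
  exists f : set_type (vertices G) -> set_type (vertices H), bijective f /\
    forall x y : set_type (vertices G), adjacent G (val x) (val y) <->
      adjacent H (val (f x)) (val (f y)).

Variant color := Red | Blue.

(* Colorings are total on [set U]; their values off the edge set of the graph
   being colored play no role. *)
Definition has_mono_copy U V (F : graph U) (c : set U -> color) (k : color)
    (G : graph V) : Prop :=
  exists K : graph U,
    [/\ subgraph K F, isomorphic K G & forall e, edges K e -> c e = k].

Definition arrows U V W (F : graph U) (G : graph V) (H : graph W) : Prop :=
  forall c : set U -> color, has_mono_copy F c Red G \/ has_mono_copy F c Blue H.

Definition minimal U V W (G : graph V) (H : graph W) (F : graph U) : Prop :=
  arrows F G H /\
  forall F' : graph U, proper_subgraph F' F -> ~ arrows F' G H.

(* R(G,H), restricted to graphs whose vertices are taken from [U]. *)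
Definition ramsey_minimal U V W (G : graph V) (H : graph W) : set (graph U) :=
  [set F | minimal G H F].

(* The centre is [None], the leaves are the [Some k]. *)
Definition star_edges : set (set (option nat)) :=
  [set e | exists k, e = [set None; Some k]].

Fact star_edges_pair e : star_edges e ->
  exists x y, [/\ [set: option nat] x, [set: option nat] y, x <> y
                & e = [set x; y]].
Proof. by case=> k ->; exists None, (Some k). Qed.

Fact star_no_isolated x : [set: option nat] x -> exists2 e, star_edges e & e x.
Proof.
move=> _; case: x => [k|].
- by exists [set None; Some k]; [exists k | right].
- by exists [set None; Some 0]; [exists 0 | left].
Qed.

Definition star_inf : graph (option nat) :=
  Graph star_edges_pair star_no_isolated (countableP _).

Definition matching_edges n : set (set ('I_n * bool)) :=
  [set e | exists i, e = [set (i, false); (i, true)]].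

Fact matching_edges_pair n e : @matching_edges n e ->
  exists x y, [/\ [set: 'I_n * bool] x, [set: 'I_n * bool] y, x <> y
                & e = [set x; y]].
Proof. by case=> i ->; exists (i, false), (i, true). Qed.

Fact matching_no_isolated n x :
  [set: 'I_n * bool] x -> exists2 e, @matching_edges n e & e x.
Proof.
case: x => i b _; exists [set (i, false); (i, true)]; first by exists i.
by case: b; [right | left].
Qed.

Definition matching n : graph ('I_n * bool) :=
  Graph (@matching_edges_pair n) (@matching_no_isolated n) (countableP _).

(* Main.v *)
(* Deleting any edge from a graph F with F -> (S_oo, nK_2) preserves the arrow,
   so F is never minimal: extend a coloring of F - e by making e red.  A blue
   copy of nK_2 in F then avoids e, and a red S_oo in F that uses e still
   contains a red S_oo avoiding e. *)
Require Import Defs.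
From mathcomp Require Import all_boot.
From mathcomp Require Import boolp classical_sets functions cardinality.

Set Implicit Arguments.
Unset Strict Implicit.
Unset Printing Implicit Defensive.

Local Open Scope classical_set_scope.

Lemma edge_subset_vertices V (G : graph V) (e : set V) :
  edges G e -> e `<=` vertices G.
Proof. by move=> /edges_pair[x [y [Gx Gy _ ->]]] z [->|->]. Qed.

(** Without isolated vertices, every vertex of [H] lies on an edge of [H], hence on one of [G]. *)
Lemma edges_subset_subgraph V (H G : graph V) :
  edges H `<=` edges G -> subgraph H G.
Proof.
move=> HG; split=> // x Hx; have [e He ex] := no_isolated Hx.
exact: edge_subset_vertices (HG _ He) _ ex.
Qed.

Section DeleteEdge.
Variables (V : Type) (G : graph V) (e : set V).

Let delete_edges : set (set V) := edges G `\ e.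
(** An endpoint of [e] that lies on no other edge must go as well, since graphs have no isolated
    vertices; that condition then holds by definition. *)
Let delete_vertices : set V := [set x | exists2 d, delete_edges d & d x].

Let delete_edges_pair d : delete_edges d -> exists x y,
  [/\ delete_vertices x, delete_vertices y, x <> y & d = [set x; y]].
Proof.
move=> Gd; have [x [y [_ _ xy dE]]] := edges_pair Gd.1.
by exists x, y; split=> //; exists d; rewrite // dE; [left | right].
Qed.

Let delete_countable : countable delete_vertices.
Proof.
apply: sub_countable (vertices_countable G); apply: subset_card_le.
by move=> x [d [Gd _]]; apply: edge_subset_vertices.
Qed.

Definition delete_edge : graph V :=
  @Graph V delete_vertices delete_edges delete_edges_pair (fun x Gx => Gx)
    delete_countable.

End DeleteEdge.

Lemma injective_image_set V W (f : V -> W) :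
  injective f -> injective (fun A : set V => f @` A).
Proof.
move=> f_inj A B AB; apply/funext => x.
by rewrite -(image_inj (A := A) f_inj) AB image_inj.
Qed.

Section ImageGraph.
Variables (V W : Type) (f : V -> W) (f_inj : injective f) (G : graph V).

Let image_edges_pair e : [set f @` d | d in edges G] e -> exists x y,
  [/\ (f @` vertices G) x, (f @` vertices G) y, x <> y & e = [set x; y]].
Proof.
case=> d /edges_pair[x [y [Gx Gy xy ->]]] <-.
exists (f x), (f y); split; [by exists x|by exists y|by move/f_inj|].
by rewrite image_setU !image_set1.
Qed.

Let image_no_isolated x : (f @` vertices G) x ->
  exists2 e, [set f @` d | d in edges G] e & e x.
Proof.
case=> y Gy <-; have [d Gd dy] := no_isolated Gy.
by exists (f @` d); [exists d | exists y].
Qed.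

Let image_countable : countable (f @` vertices G).
Proof. exact: sub_countable (card_image_le _ _) (vertices_countable G). Qed.

(** Serves to build a star inside another one, as the image of [star_inf] under a reindexing of the
    leaves. *)
Definition image_graph : graph W :=
  Graph image_edges_pair image_no_isolated image_countable.

Lemma adjacent_image (x y : V) :
  adjacent image_graph (f x) (f y) <-> adjacent G x y.
Proof.
have fE : [set f x; f y] = f @` [set x; y] by rewrite image_setU !image_set1.
rewrite /adjacent /= fE; split=> [[d Gd]|Gxy]; last by exists [set x; y].
by move/(injective_image_set f_inj) <-.
Qed.

Lemma isomorphic_image : isomorphic image_graph G.
Proof.
pose B (x : set_type (vertices G)) : set_type (vertices image_graph) :=
  SigSub (mem_set (imageP f (set_valP x))).
(* The isomorphism runs from the image back to [G]: it picks preimages under [B], and [B] is its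
   inverse. *)
have pre (y : set_type (vertices image_graph)) : {x | B x = y}.
  have [x Gx xy] := cid2 (set_valP y).
  by exists (SigSub (mem_set Gx)); apply/val_inj.
have B_inj : injective B.
  by move=> x y /(congr1 val)/f_inj /val_inj.
exists (fun y => sval (pre y)); split.
  exists B => [y|x]; first exact: (svalP (pre y)).
  exact/B_inj/(svalP (pre (B x))).
move=> x y; rewrite -adjacent_image.
by rewrite -{1}(svalP (pre x)) -{1}(svalP (pre y)).
Qed.

End ImageGraph.

Lemma isomorphic_star_spokes U (K : graph U) : isomorphic K star_inf ->
  exists2 g : option nat -> U, injective g &
    forall i, edges K [set g None; g (Some i)].
Proof.
case=> f [[f' fK f'K] adjf].
pose t (x : option nat) : set_type (vertices star_inf) :=
  SigSub (mem_set (I : [set: option nat] x)).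
exists (fun x => val (f' (t x))).
  by move=> x y /val_inj /(can_inj f'K) /(congr1 val).
by move=> i; apply/adjf; rewrite !f'K /=; exists i.
Qed.

(** At most one spoke of the star equals [e], and discarding finitely many leaves of an infinite
    star leaves an infinite star. *)
Lemma star_avoiding_edge U (K : graph U) (e : set U) :
  isomorphic K star_inf ->
  exists K' : graph U, isomorphic K' star_inf /\ edges K' `<=` edges K `\ e.
Proof.
move=> /isomorphic_star_spokes[g g_inj Kg].
(* If [e] is a spoke, [k] is its index, unique because [g] is injective; otherwise any bound works,
   here 0. *)
have [k ke] : exists k, forall i, e = [set g None; g (Some i)] -> i <= k.
  have [[k ek]|ne] :=
    pselect (exists k, e = [set g None; g (Some k)]); last first.
    by exists 0 => i ei; case: ne; exists i.
  exists k => i; rewrite ek => ik.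
  have : [set g None; g (Some k)] (g (Some i)) by rewrite ik; right.
  by case=> /g_inj // [->].
(* The shift fixes the centre and moves every leaf to an index above [k], beyond the spoke [e]. *)
pose s := omap (addn k.+1).
have s_inj : injective s by move=> [x|] [y|] //= [/addnI ->].
exists (image_graph (inj_comp g_inj s_inj) star_inf).
split; first exact: isomorphic_image.
move=> _ [_ [i ->] <-]; rewrite image_setU !image_set1 /=.
split; first exact: Kg.
by move/esym/ke; rewrite addSn ltnNge leq_addr.
Qed.

Lemma arrows_star_delete_edge U W (F : graph U) (H : graph W) (e : set U) :
  arrows F star_inf H -> arrows (delete_edge F e) star_inf H.
Proof.
move=> FH c; pose c' d := if pselect (d = e) then Red else c d.
have c'N d : d <> e -> c' d = c d by rewrite /c'; case: pselect.
case: (FH c') => -[K [[_ KF] isoK colK]]; [left | right].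
  (* [K] may contain [e], whose color under [c] is unknown; on [K'] the colorings [c] and [c']
     agree. *)
  have [K' [isoK' K'K]] := star_avoiding_edge e isoK.
  exists K'; split=> // [|d /K'K[Kd de]]; last by rewrite -c'N // colK.
  by apply: edges_subset_subgraph => d /K'K[/KF].
have Ke d : edges K d -> d <> e.
  by move=> /colK; rewrite /c'; case: pselect.
exists K; split=> // [|d Kd]; last by rewrite -c'N ?colK //; apply: Ke.
by apply: edges_subset_subgraph => d Kd; split; [apply: KF | apply: Ke].
Qed.

Lemma isomorphic_has_edge U V (K : graph U) (G : graph V) (x : V) :
  isomorphic K G -> vertices G x -> edges K !=set0.
Proof.
move=> [f [[f' _ _] _]] Gx.
have [e Ke _] := no_isolated (set_valP (f' (SigSub (mem_set Gx)))).
by exists e.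
Qed.

Theorem theorem19 (n : nat) (hn : (1 <= n)%N) (U : Type) :
  ramsey_minimal star_inf (matching n) = set0 :> set (graph U).
Proof.
apply/seteqP; split=> // F [FH minF].
(* An edge to delete: any coloring yields a copy of the star or of the matching inside [F], and both
   have edges. For the matching this is where [hn] enters, making 0 a valid index. *)
have [e Fe] : edges F !=set0.
  have [|] := FH (fun=> Red) => -[K [[_ KF] isoK _]].
    by have [e /KF] := isomorphic_has_edge (x := None) isoK I; exists e.
  have [e /KF] := isomorphic_has_edge (x := (Ordinal hn, true)) isoK I.
  by exists e.
apply: (minF (delete_edge F e)); last exact: arrows_star_delete_edge.
split; first by apply: edges_subset_subgraph => d [].
split; first by move=> d [].
by move=> /(_ e Fe)[_]; apply.
Qed.
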